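(* Let $d \equiv 2 \pmod 4$ be a square-free positive integer such that both equations $x^2 - dy^2 = -1$ and $x^2 - dy^2 = 6$ have solutions in integers $x, y$. Let $n = (4m+2) + 4k\sqrt{d}$ with $m, k \in \mathbb{Z}$, and suppose that $(m,k)$ satisfies neither ($m \equiv 9 \pmod{12}$ and $k \equiv 3 \pmod 6$) nor ($m \equiv 0 \pmod{12}$ and $k \equiv 0 \pmod 6$). Then there exist infinitely many $D(n)$-quadruples in $\mathbb{Z}[\sqrt{d}]$.
   Context: For $n \in \mathbb{Z}[\sqrt{d}]$, a set $\{a_1,a_2,a_3,a_4\}$ of four distinct non-zero elements of $\mathbb{Z}[\sqrt{d}]$ is called a $D(n)$-quadruple in $\mathbb{Z}[\sqrt{d}]$ if $a_ia_j + n$ is a square of an element of $\mathbb{Z}[\sqrt{d}]$ for all $1 \le i < j \le 4$. *)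

(* Defs.v *)
From HB Require Import structures.
From mathcomp Require Import all_boot all_order all_algebra.
From mathcomp Require Import finmap.
Set Implicit Arguments. Unset Strict Implicit. Unset Printing Implicit Defensive.
Import Order.TTheory GRing.Theory Num.Theory.
Local Open Scope ring_scope.

(* An element a + b*sqrt(d) of Z[sqrt d] is represented by the pair (a, b).
   For non-square d this representation is unique. *)
Definition zsqrt := (int * int)%type.

Definition zs_add (x y : zsqrt) : zsqrt := (x.1 + y.1, x.2 + y.2).
Definition zs_mul (d : int) (x y : zsqrt) : zsqrt :=
  (x.1 * y.1 + d * x.2 * y.2, x.1 * y.2 + x.2 * y.1).

Definition zs_is_square (d : int) (z : zsqrt) : Prop :=
  exists w : zsqrt, zs_mul d w w = z.

Definition squarefree_int (d : int) : Prop :=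
  forall e : int, (e * e %| d)%Z -> e * e = 1.

Definition Dn_quadruple (d : int) (n : zsqrt) (S : {fset zsqrt}) : Prop :=
  [/\ #|` S| = 4%N, (0, 0) \notin S &
      forall a b : zsqrt, a \in S -> b \in S -> a != b ->
        zs_is_square d (zs_add (zs_mul d a b) n)].

Definition infinitely_many_Dn_quadruples (d : int) (n : zsqrt) : Prop :=
  ~ exists L : seq {fset zsqrt},
      forall S, Dn_quadruple d n S -> S \in L.

(* Main.v *)
(** Every quadruple used is [{a, b, a + b + 2r, a + 4b + 4r}] with
    [a b + n = r^2]; it is a [D(n)]-quadruple as soon as the "center"
    [s = a + 2r] makes [s^2 - 3n] a square [y^2].  Write [n = 2N] with
    [N = (2m + 1) + 2k sqrt d] and let [beta] have norm [6 sg], [sg = 1] or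
    [-1].  Then [6 N] factors as [beta * (sg beta' N)], [beta'] the conjugate,
    so [s = (beta + sg beta' N) / 2] is a suitable center.  It remains to find
    infinitely many [a] such that [a] divides [r^2 - n] for [r = (s - a) / 2].
    The two Pell equations force [d = 2 mod 8] and [d = 1 mod 3], so the real
    part of an element of norm [6] (resp. [-6]) is [0] (resp. [2]) mod [4], and
    [3] splits.  According to [(m mod 4, k mod 2)], the choice [a = 2u] or
    [a = 4u] with [u] a unit works for a suitable [sg]; in the two classes
    [(1, 1)] and [(0, 0)] one takes [a] of norm [-6 sg].  In this last case the
    prime above [3] dividing [a] divides [r^2 - n] if one root [K] of [d]
    mod [3] satisfies [m <> K k mod 3], which excludes exactly the exceptional
    pairs.  Distinctness of the four elements fails only for roots of finitely
    many quadratic polynomials in [a], read in the complex numbers. *)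
Require Import Defs.
From mathcomp Require Import all_boot all_order all_algebra all_field.
From mathcomp Require Import finmap.
From mathcomp Require Import zify ring lra.
Import Order.TTheory GRing.Theory Num.Theory.
Local Open Scope ring_scope.

(** * Embedding of [Z[sqrt d]] in the algebraic numbers *)

Definition zs_val (d : int) (x : zsqrt) : algC :=
  x.1%:~R + x.2%:~R * sqrtC d%:~R.

Lemma zs_valD d x y : zs_val d (zs_add x y) = zs_val d x + zs_val d y.
Proof. by rewrite /zs_val /= !intrD; ring. Qed.

Lemma zs_valM d x y : zs_val d (zs_mul d x y) = zs_val d x * zs_val d y.
Proof.
have hw := sqrtCK (d%:~R : algC).
rewrite /zs_val /=; set w := sqrtC _ in hw *.
by rewrite !intrD !intrM -hw; ring.
Qed.

Lemma modz_witness (x q r : int) : (x %% q)%Z = r -> exists e, x = q * e + r.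
Proof. by move=> <-; exists (x %/ q)%Z; rewrite mulrC -divz_eq. Qed.

(** Irrationality of [sqrt d]: a nonzero [v] would divide [u] and make [d] a square, while squares
    are 0 or 1 mod 4. *)
Lemma sqr_eq_mul_sqr (d u v : int) : (d %% 4)%Z = 2 -> u ^+ 2 = d * v ^+ 2 -> v = 0.
Proof.
move=> hd huv; apply/eqP; apply/negP=> /negP v0.
have : (v %| u)%Z.
  by rewrite -(@dvdz_pexp2r _ _ 2) //; apply/dvdzP; exists d.
case/dvdzP=> c hc.
have hcd : c ^+ 2 = d.
  have v2 : v ^+ 2 != 0 by rewrite expf_eq0.
  by apply: (mulIf v2); rewrite -huv hc exprMn.
have [q [i [hi hq]]] : exists q i : int, (i = 0 \/ i = 1) /\ c = 2 * q + i.
  exists (c %/ 2)%Z, (c %% 2)%Z; lia.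
move: hcd; rewrite hq; case: hi => -> h; lia.
Qed.

Lemma zs_val_inj d : (d %% 4)%Z = 2 -> injective (zs_val d).
Proof.
move=> hd [x1 x2] [y1 y2]; rewrite /zs_val /= => h.
have hw := sqrtCK (d%:~R : algC).
set w := sqrtC _ in h hw.
have h1 : ((x1 - y1) ^+ 2)%:~R = (d * (x2 - y2) ^+ 2)%:~R :> algC.
  have e : (x1 - y1)%:~R = (y2 - x2)%:~R * w :> algC.
    by rewrite !intrB; move/eqP: h; rewrite -subr_eq0 => /eqP h;
      apply/eqP; rewrite -subr_eq0; apply/eqP; rewrite -h; ring.
  by rewrite rmorphXn /= e intrM rmorphXn /= -hw !intrB; ring.
have {}h1 := intr_inj h1.
have h2 := sqr_eq_mul_sqr d _ _ hd h1.
move: h1; rewrite h2 expr0n /= mulr0 => /eqP; rewrite expf_eq0 /= => /eqP h3.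
congr pair; lia.
Qed.

(** The product of the polynomials is nonzero, so it has fewer than [size p] roots, while [f] takes
    [size p] distinct values on [iota 0 (size p)]. *)
Lemma avoid_roots (f : nat -> algC) (ps : seq {poly algC}) :
  injective f -> 0 \notin ps -> exists j, all (fun p : {poly algC} => p.[f j] != 0) ps.
Proof.
move=> finj ps0; pose p := \prod_(q <- ps) q.
have p0 : p != 0.
  by rewrite prodf_seq_neq0; apply/allP=> q qps /=; apply: contraNneq ps0 => <-.
pose rs := [seq f i | i <- iota 0 (size p)].
have /allPn [_ /mapP [j _ ->] hj] : ~~ all (root p) rs.
  apply/negP=> /(max_poly_roots p0) h.
  have := h _; rewrite map_inj_uniq // iota_uniq => /(_ isT).
  by rewrite size_map size_iota ltnn.
by exists j; move: hj; rewrite /root /p horner_prod prodf_seq_neq0.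
Qed.

Definition quad (a b c : algC) : {poly algC} := a *: 'X^2 + b *: 'X + c%:P.

Lemma horner_quad a b c x : (quad a b c).[x] = a * x ^+ 2 + b * x + c.
Proof. by rewrite /quad !hornerE. Qed.

Lemma quad_neq0 a b c : a != 0 -> 0 != quad a b c.
Proof.
apply: contra_neq => /(congr1 (fun p : {poly algC} => p`_2)).
by rewrite coef0 /quad !coefD !coefZ coefXn coefX coefC /= mulr1 mulr0 !addr0.
Qed.

(** * Regular quadruples and infinite families of them *)

Lemma zs_mulC d x y : zs_mul d x y = zs_mul d y x.
Proof. by rewrite /zs_mul; congr pair; ring. Qed.

(** Given [a b + n = r^2], the products [a c], [b c], [b e] and [c e] become squares by polynomial
    identities. Only [a e + n = (a + 2r)^2 - 3n] needs the hypothesis on [y]. *)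
Lemma regular_quadruple (d : int) (n a b c e r y : zsqrt) :
  zs_add (zs_mul d a b) n = zs_mul d r r ->
  zs_mul d (zs_add a (zs_add r r)) (zs_add a (zs_add r r)) =
    zs_add (zs_mul d y y) (zs_add n (zs_add n n)) ->
  c = zs_add (zs_add a b) (zs_add r r) ->
  e = zs_add (zs_add c (zs_add b b)) (zs_add b (zs_add r r)) ->
  uniq [:: (0, 0); a; b; c; e] ->
  Dn_quadruple d n [fset x in [:: a; b; c; e]]%fset.
Proof.
move=> hr hy hc he /andP[nz hu].
have sq x z t : zs_mul d t t = zs_add (zs_mul d x z) n ->
    zs_is_square d (zs_add (zs_mul d x z) n) /\
    zs_is_square d (zs_add (zs_mul d z x) n).
  by move=> h; split; exists t; rewrite // h zs_mulC.
have [ab ba] := sq a b r (esym hr).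
have [hac hbc hae hbe hce] :
  [/\ zs_mul d (zs_add a r) (zs_add a r) = zs_add (zs_mul d a c) n,
      zs_mul d (zs_add b r) (zs_add b r) = zs_add (zs_mul d b c) n,
      zs_mul d y y = zs_add (zs_mul d a e) n,
      zs_mul d (zs_add b (zs_add b r)) (zs_add b (zs_add b r)) =
        zs_add (zs_mul d b e) n &
      zs_mul d (zs_add c (zs_add b r)) (zs_add c (zs_add b r)) =
        zs_add (zs_mul d c e) n].
  move: hr hy; rewrite {}he {}hc {nz hu sq ab ba}.
  case: a b r n y => [a1 a2] [b1 b2] [r1 r2] [n1 n2] [y1 y2].
  rewrite /zs_add /zs_mul /= => -[hr1 hr2] [hy1 hy2].
  by split; congr pair; lra.
have [ac ca] := sq _ _ _ hac; have [bc cb] := sq _ _ _ hbc.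
have [ae ea] := sq _ _ _ hae; have [be eb] := sq _ _ _ hbe.
have [ce ec] := sq _ _ _ hce.
split.
- by rewrite card_fseq undup_id.
- by rewrite in_fset.
move=> u v; rewrite !in_fset !inE.
by case/or4P=> /eqP -> /or4P [] /eqP -> //; rewrite eqxx.
Qed.

(* [a + 4b + 4r = (s^2 - 4n) / a] for every [a], whence the hypothesis [s^2 <> 4n];
   the case [b = a + b + 2r] is [s = 0]. *)
Lemma infinitely_many_regular (d : int) (n s y : zsqrt) (A : nat -> zsqrt) :
  (d %% 4)%Z = 2 -> injective A -> s != (0, 0) ->
  zs_mul d s s = zs_add (zs_mul d y y) (zs_add n (zs_add n n)) ->
  zs_mul d s s != zs_add (zs_add n n) (zs_add n n) ->
  (forall j, exists r b, s = zs_add (A j) (zs_add r r) /\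
     zs_add (zs_mul d (A j) b) n = zs_mul d r r) ->
  infinitely_many_Dn_quadruples d n.
Proof.
move=> hd Ainj s0 hy s4n hA [L hL].
have vinj := zs_val_inj d hd; set v := zs_val d in vinj.
have vD x z : v (zs_add x z) = v x + v z := zs_valD d x z.
have vM x z : v (zs_mul d x z) = v x * v z := zs_valM d x z.
have v0 : v (0, 0) = 0 by rewrite /v /zs_val /= mul0r addr0.
pose f j := v (A j); pose D := v s ^+ 2 - 4 * v n.
have D0 : D != 0.
  apply: contra_neq s4n => hD; apply: vinj.
  by move/eqP: hD; rewrite subr_eq0 => /eqP hD; rewrite vM -expr2 hD !vD; ring.
have vs0 : v s != 0 by apply: contra_neq s0 => hs; apply: vinj; rewrite v0.
(* At [a] these take the values [4ab], [4ac], [4a(a - b)], [4a(a - c)], [a(a - e)], [4a(b - e)],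
   [4a(c - e)], where [b], [c], [e] are eliminated through [2r = s - a] and [D = a e]. *)
pose qs := [:: quad 1 (- 2 * v s) D; quad 1 (2 * v s) D;
  quad 3 (2 * v s) (- D); quad 3 (- 2 * v s) (- D); quad 1 0 (- D);
  quad 1 (- 2 * v s) (- 3 * D); quad 1 (2 * v s) (- 3 * D)].
(* These vanish at every element of every set in [L]; avoiding them puts [a], hence its quadruple,
   outside the list. *)
pose es := [seq 'X - (v a)%:P | a <- flatten [seq enum_fset X | X <- L]].
have [j] : exists j, all (fun p : {poly algC} => p.[f j] != 0) (qs ++ es).
  apply: avoid_roots => [i j /vinj /Ainj //|].
  rewrite mem_cat negb_or; apply/andP; split; last first.
    by apply/mapP => -[a _ /eqP]; rewrite eq_sym polyXsubC_eq0.
  by rewrite !inE !negb_or !quad_neq0 ?oner_eq0 ?pnatr_eq0.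
rewrite all_cat => /andP[hq he].
have [r [b [hs hb]]] := hA j.
set a := A j in hs hb.
pose c := zs_add (zs_add a b) (zs_add r r).
pose e := zs_add (zs_add c (zs_add b b)) (zs_add b (zs_add r r)).
have := hy; rewrite {1 2}hs => hy'.
have hu : uniq [:: (0, 0); a; b; c; e].
  apply: (@map_uniq _ _ v); rewrite /= v0.
  have hvs : v s = v a + 2 * v r by rewrite hs !vD; ring.
  have hvn : v n = v r ^+ 2 - v a * v b.
    by move/(congr1 v): hb; rewrite vD !vM => hb'; rewrite expr2 -hb'; ring.
  have hc : v c = v a + v b + 2 * v r by rewrite !vD; ring.
  have hve : v e = v a + 4 * v b + 4 * v r by rewrite !vD; ring.
  have hD : D = v a * v e by rewrite /D hvs hvn hve; ring.
  move: D0; rewrite hD mulf_eq0 negb_or => /andP[a0 e0].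
  move: hq; rewrite /= !horner_quad hD hvs /f -/a.
  rewrite (_ : _ + _ = 4 * v a * v b); last by rewrite hve; ring.
  rewrite (_ : _ + _ = 4 * v a * v c); last by rewrite hve hc; ring.
  rewrite (_ : _ + _ = 4 * v a * (v a - v b)); last by rewrite hve; ring.
  rewrite (_ : _ + _ = 4 * v a * (v a - v c)); last by rewrite hve hc; ring.
  rewrite (_ : _ + _ = v a * (v a - v e)); last by ring.
  rewrite (_ : _ + _ = 4 * v a * (v b - v e)); last by rewrite hve; ring.
  rewrite (_ : _ + _ = 4 * v a * (v c - v e)); last by rewrite hve hc; ring.
  rewrite !mulf_eq0 !negb_or !subr_eq0 andbT.
  move=> /and5P[/andP[_ b0] /andP[_ c0] /andP[_ ab] /andP[_ ac]].
  move=> /and3P[/andP[_ ae] /andP[_ be] /andP[_ ce]].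
  have bc : v b != v c.
    apply: contra_neq vs0 => hbc; rewrite hvs; move: hc; rewrite -hbc => hc.
    by rewrite -(subrr (v b)) {1}hc; ring.
  by rewrite !(eq_sym 0) a0 b0 c0 e0 ab ac ae bc be ce.
have /hL hS := regular_quadruple d n a b c e r y hb hy' erefl erefl hu.
have /(allP he) : 'X - (v a)%:P \in es.
  apply: map_f; apply/flattenP; exists (enum_fset [fset x in [:: a; b; c; e]]%fset).
    exact: map_f.
  have : a \in [fset x in [:: a; b; c; e]]%fset by rewrite in_fset inE eqxx.
  by [].
by rewrite !hornerE subrr eqxx.
Qed.

(** * Division in [Z[sqrt d]] and congruences from the two Pell equations *)

(** To divide [z] by [a], multiply by the conjugate of [a] and divide by the norm [nu]; the last two
    hypotheses are the two coordinates of this computation. *)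
Lemma zs_div (d a1 a2 z1 z2 b1 b2 nu : int) :
  a1 ^+ 2 - d * a2 ^+ 2 = nu -> nu != 0 ->
  z1 * a1 - d * z2 * a2 = nu * b1 -> z2 * a1 - z1 * a2 = nu * b2 ->
  zs_mul d (a1, a2) (b1, b2) = (z1, z2).
Proof.
move=> hnu nu0 h1 h2; rewrite /zs_mul /=; congr pair; apply: (mulfI nu0).
  rewrite (_ : nu * _ = a1 * (nu * b1) + d * a2 * (nu * b2)); last by ring.
  by rewrite -h1 -h2 -hnu; ring.
rewrite (_ : nu * _ = a1 * (nu * b2) + a2 * (nu * b1)); last by ring.
by rewrite -h1 -h2 -hnu; ring.
Qed.

Lemma half_int (x : int) : exists h, x = 2 * h \/ x = 2 * h + 1.
Proof. exists (x %/ 2)%Z; lia. Qed.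

Lemma third_int (x : int) : exists h, [\/ x = 3 * h, x = 3 * h + 1 | x = 3 * h + 2].
Proof.
exists (x %/ 3)%Z.
have [h|[h|h]] : x = 3 * (x %/ 3)%Z \/ x = 3 * (x %/ 3)%Z + 1 \/ x = 3 * (x %/ 3)%Z + 2 by lia.
- by constructor 1.
- by constructor 2.
- by constructor 3.
Qed.

Lemma unit_odd (d u1 u2 : int) :
  (d %% 4)%Z = 2 -> u1 ^+ 2 - d * u2 ^+ 2 = 1 -> exists h, u1 = 2 * h + 1.
Proof.
move=> hd hu; have [h [e|e]] := half_int u1; last by exists h.
have [e' hd'] := modz_witness _ _ _ hd.
move: hu; rewrite e hd'; lia.
Qed.

(** Both [p] and [q] are odd, and odd squares are 1 mod 8 because [g (g + 1)] is even; the equation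
    then reads [2 = d] mod 8. *)
Lemma negative_pell_mod8 (d p q : int) :
  (d %% 4)%Z = 2 -> p ^+ 2 - d * q ^+ 2 = -1 -> (d %% 8)%Z = 2.
Proof.
move=> hd.
have [e hd'] := modz_witness _ _ _ hd.
rewrite hd'.
have [g [->|->]] := half_int p; have [h [->|->]] := half_int q; try lia.
have [a ha] : exists a, g * (g + 1) = 2 * a.
  by have [i [->|->]] := half_int g; [exists (i * (2 * i + 1)) | exists ((2 * i + 1) * (i + 1))]; ring.
have [b hb] : exists a, h * (h + 1) = 2 * a.
  by have [i [->|->]] := half_int h; [exists (i * (2 * i + 1)) | exists ((2 * i + 1) * (i + 1))]; ring.
move=> hh.
have : 8 * a + 2 = (4 * e + 2) * (8 * b + 1).
  rewrite (_ : 8 * a = 4 * (2 * a)); last by ring.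
  rewrite (_ : 8 * b = 4 * (2 * b)); last by ring.
  by rewrite -ha -hb; lia.
lia.
Qed.

(** If [d = 0] mod 3, then [-1] would be a square mod 3. If [d = 2], then [x^2 + y^2 = 0] mod 3
    makes 3 divide both [x] and [y], and 9 would divide 6. *)
Lemma negative_pell_norm6_mod3 (d p q x y : int) :
  p ^+ 2 - d * q ^+ 2 = -1 -> x ^+ 2 - d * y ^+ 2 = 6 -> (d %% 3)%Z = 1.
Proof.
have [e [->|->|->]] := third_int d.
- by have [a [->|->|->]] := third_int p; lia.
- lia.
- move=> _; have [a [->|->|->]] := third_int x; have [b [->|->|->]] := third_int y; lia.
Qed.

(** With [x = 2a] and [y] odd, [2 a^2 = 3 + (d / 2) y^2] is 0 mod 4, since [d / 2 = 1] mod 4. *)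
Lemma norm6_mod4 (d x y : int) :
  (d %% 8)%Z = 2 -> x ^+ 2 - d * y ^+ 2 = 6 -> (x %% 4)%Z = 0 /\ (y %% 2)%Z = 1.
Proof.
move=> hd; have [e ->] := modz_witness _ _ _ hd.
have [a [->|->]] := half_int x; have [b [->|->]] := half_int y; try lia.
have [c [->|->]] := half_int a; lia.
Qed.

Lemma normN6_mod4 (d x y : int) :
  (d %% 8)%Z = 2 -> x ^+ 2 - d * y ^+ 2 = -6 -> (x %% 4)%Z = 2 /\ (y %% 2)%Z = 1.
Proof.
move=> hd; have [e ->] := modz_witness _ _ _ hd.
have [a [->|->]] := half_int x; have [b [->|->]] := half_int y; try lia.
have [c [->|->]] := half_int a; have [f [->|->]] := half_int b; lia.
Qed.

(** * Units, elements of norm 6 or -6, and the center *)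

Definition zs_norm (d : int) (x : zsqrt) : int := x.1 ^+ 2 - d * x.2 ^+ 2.

Lemma zs_normM d x y : zs_norm d (zs_mul d x y) = zs_norm d x * zs_norm d y.
Proof. by rewrite /zs_norm /=; ring. Qed.

Lemma unit_seq (d p q : int) :
  0 < d -> (d %% 4)%Z = 2 -> p ^+ 2 - d * q ^+ 2 = -1 ->
  exists U : nat -> zsqrt, injective U /\ forall j, zs_norm d (U j) = 1.
Proof.
move=> d0 hd hpq.
have q0 : q != 0.
  by apply/eqP=> q0; move: hpq; rewrite q0 expr0n mulr0 subr0 => h; have := sqr_ge0 p; rewrite h.
have p0 : p != 0.
  apply/eqP=> p0; have [e hde] := modz_witness _ _ _ hd.
  by move: hpq; rewrite p0 hde expr0n /=; lia.
(* The square of [p + q sqrt d], up to conjugation. The absolute value makes both coordinates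
   positive, so the second coordinates of the powers of [E] increase strictly. *)
pose E : zsqrt := (p ^+ 2 + d * q ^+ 2, 2 * `|p * q|).
have hE : zs_norm d E = 1.
  rewrite /zs_norm /= exprMn real_normK ?num_real //.
  have -> : (p ^+ 2 + d * q ^+ 2) ^+ 2 - d * (2 ^+ 2 * (p * q) ^+ 2) =
            (p ^+ 2 - d * q ^+ 2) ^+ 2 by ring.
  by rewrite hpq; ring.
have E1 : 1 < E.1.
  have : 0 < p ^+ 2 by rewrite exprn_even_gt0.
  by rewrite /E /=; lia.
have E2 : 0 < E.2 by rewrite /E /= mulr_gt0 // normr_gt0 mulf_neq0.
pose U j := iter j (zs_mul d E) (1, 0).
have Upos j : 0 < (U j).1 /\ 0 <= (U j).2.
  elim: j => [//|j [h1 h2]]; rewrite /U iterS -/(U j) /=.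
  by split; [apply: ltr_wpDr | apply: addr_ge0]; rewrite ?mulr_gt0 ?mulr_ge0 //; lia.
have Umono : {homo (fun j => (U j).2) : i j / (i < j)%N >-> i < j}.
  apply: homo_ltn => [? ? ?|j]; first exact: lt_trans.
  have [h1 h2] := Upos j.
  have h3 : 0 < E.2 * (U j).1 by rewrite mulr_gt0.
  have h4 : (U j).2 <= E.1 * (U j).2 by rewrite ler_peMl // ltW.
  suff: (U j).2 < E.1 * (U j).2 + E.2 * (U j).1 by [].
  by rewrite ltr_pwDr.
exists U; split=> [i j hij|].
  by case: (ltngtP i j) => // /Umono; rewrite hij ltxx.
elim=> [|j hj]; first by rewrite /zs_norm /= expr0n mulr0.
by rewrite /U iterS zs_normM hE hj.
Qed.

Lemma zs_mul_inj d a : (d %% 4)%Z = 2 -> zs_norm d a != 0 -> injective (zs_mul d a).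
Proof.
move=> hd a0 x y hxy; apply: (zs_val_inj d hd).
have : zs_val d a != 0.
  apply: contraNneq a0 => ha.
  have -> : a = (0, 0) by apply: (zs_val_inj d hd); rewrite ha /zs_val /= mul0r addr0.
  by rewrite /zs_norm /= expr0n mulr0.
by move/mulfI; apply; rewrite -!zs_valM hxy.
Qed.

Lemma norm_mod3 (d x y c : int) :
  (d %% 3)%Z = 1 -> x ^+ 2 - d * y ^+ 2 = 3 * c ->
  (3 %| x - y)%Z \/ (3 %| x + y)%Z.
Proof.
move=> hd; have [e ->] := modz_witness _ _ _ hd.
move=> h; apply/orP; rewrite !dvdzE -Euclid_dvdM // -abszM -dvdzE; apply/dvdzP.
exists (c + e * y ^+ 2).
by rewrite (_ : _ * _ = x ^+ 2 - y ^+ 2); last ring; lia.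
Qed.

(** The sign [K] selects one of the two primes above 3. A factor [p + q sqrt d] adjusts the sign of
    the norm, conjugation exchanges the two primes, and multiplication by units preserves both
    conditions. *)
Lemma norm6_seq (d p q x y sg K : int) :
  0 < d -> (d %% 4)%Z = 2 -> p ^+ 2 - d * q ^+ 2 = -1 -> x ^+ 2 - d * y ^+ 2 = 6 ->
  sg ^+ 2 = 1 -> K ^+ 2 = 1 ->
  exists W : nat -> zsqrt, injective W /\
    forall j, zs_norm d (W j) = 6 * sg /\ (3 %| (W j).1 - K * (W j).2)%Z.
Proof.
move=> d0 hd hpq hxy hsg hK; have hd3 := negative_pell_norm6_mod3 _ _ _ _ _ hpq hxy.
have [e hde] := modz_witness _ _ _ hd3.
have [U [Uinj hU]] := unit_seq d p q d0 hd hpq.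
have [a ha] : exists a, zs_norm d a = 6 * sg.
  move/eqP: hsg; rewrite sqrf_eq1 => /orP[] /eqP ->; first by exists (x, y).
  by exists (zs_mul d (p, q) (x, y)); rewrite zs_normM /zs_norm /= hpq hxy.
have [b hb hb3] : exists2 b, zs_norm d b = 6 * sg & (3 %| b.1 - K * b.2)%Z.
  have h3 : (3 %| a.1 - K * a.2)%Z \/ (3 %| a.1 + K * a.2)%Z.
    have h : a.1 ^+ 2 - d * a.2 ^+ 2 = 3 * (2 * sg).
      by rewrite -/(zs_norm d a) ha; ring.
    have := norm_mod3 _ _ _ _ hd3 h.
    move/eqP: hK; rewrite sqrf_eq1 => /orP[] /eqP ->; rewrite ?mul1r // mulN1r opprK.
    by case; [right | left].
  case: h3 => h3; first by exists a.
  by exists (a.1, - a.2); rewrite /zs_norm /= ?sqrrN // mulrN opprK.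
exists (fun j => zs_mul d b (U j)); split.
  move=> i j /zs_mul_inj h; apply/Uinj/h => //.
  by rewrite hb mulf_neq0 //; apply: contra_eq_neq hsg => ->; rewrite expr0n.
move=> j; split; first by rewrite zs_normM hb hU mulr1.
rewrite (_ : _ - _ = (b.1 - K * b.2) * (U j).1 - K * (b.1 - K * b.2) * (U j).2
   + 3 * (e * b.2 * (U j).2)); last first.
  rewrite /= hde; have -> : K * (b.1 - K * b.2) = K * b.1 - K ^+ 2 * b.2 by ring.
  by rewrite hK; ring.
apply: rpredD; last exact: dvdz_mulr.
by apply: rpredB; rewrite dvdz_mulr // dvdz_mull.
Qed.

(* In terms of [beta], [s = 0] means [beta^2 = -6N], and [s^2 = 4n] means
   [(beta^2 - 2N)(beta^2 - 18N) = 0]. *)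
Lemma center_exists (d p q x y sg K m k : int) :
  0 < d -> (d %% 4)%Z = 2 -> p ^+ 2 - d * q ^+ 2 = -1 -> x ^+ 2 - d * y ^+ 2 = 6 ->
  sg ^+ 2 = 1 -> K ^+ 2 = 1 ->
  let n := (4 * m + 2, 4 * k) in
  exists b s : zsqrt,
    [/\ zs_norm d b = 6 * sg, (3 %| b.1 - K * b.2)%Z,
        2 * s.1 = b.1 + sg * (b.1 * (2 * m + 1) - 2 * k * d * b.2) /\
        2 * s.2 = b.2 + sg * (2 * k * b.1 - b.2 * (2 * m + 1)),
        s != (0, 0) /\ zs_mul d s s != zs_add (zs_add n n) (zs_add n n) &
        exists t, zs_mul d s s = zs_add (zs_mul d t t) (zs_add n (zs_add n n))].
Proof.
move=> d0 hd hpq hxy hsg hK n.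
have [W [Winj hW]] := norm6_seq d p q x y sg K d0 hd hpq hxy hsg hK.
have vinj := zs_val_inj d hd; set v := zs_val d in vinj.
have vD x' z : v (zs_add x' z) = v x' + v z := zs_valD d x' z.
have vM x' z : v (zs_mul d x' z) = v x' * v z := zs_valM d x' z.
have v0 : v (0, 0) = 0 by rewrite /v /zs_val /= mul0r addr0.
pose N := v (2 * m + 1, 2 * k).
pose qs := [:: quad 1 0 (6 * N); quad 1 0 (- 2 * N); quad 1 0 (- 18 * N)].
have [j] : exists j, all (fun p : {poly algC} => p.[v (W j)] != 0) qs.
  apply: avoid_roots => [i j /vinj /Winj //|].
  by rewrite !inE !negb_or !quad_neq0 ?oner_eq0.
set b := W j => hj.
have [hb hb3] := hW j; rewrite -/b in hb hb3.
have [s [hs1 hs2]] : exists s : zsqrt,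
    2 * s.1 = b.1 + sg * (b.1 * (2 * m + 1) - 2 * k * d * b.2) /\
    2 * s.2 = b.2 + sg * (2 * k * b.1 - b.2 * (2 * m + 1)).
  move/eqP: hsg; rewrite sqrf_eq1 => /orP[] /eqP ->.
    exists (b.1 * (1 + m) - k * d * b.2, k * b.1 - m * b.2); split => /=; ring.
  exists (- m * b.1 + k * d * b.2, (m + 1) * b.2 - k * b.1); split => /=; ring.
have e6 : sg * zs_norm d b = 6 by rewrite hb mulrCA -expr2 hsg mulr1.
have c1 : 2 * s.1 * b.1 + d * (2 * s.2) * b.2 =
          b.1 ^+ 2 + d * b.2 ^+ 2 + 6 * (2 * m + 1).
  by rewrite hs1 hs2 -e6 /zs_norm; ring.
have c2 : 2 * s.1 * b.2 + 2 * s.2 * b.1 = 2 * b.1 * b.2 + 6 * (2 * k).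
  by rewrite hs1 hs2 -e6 /zs_norm; ring.
(* This is [2s = b + sg b' N] multiplied by [b], as [sg b b' = 6]. *)
have hvs : 2 * v s * v b = v b ^+ 2 + 6 * N.
  have v2 : v (2, 0) = 2 by rewrite /v /zs_val /= mul0r addr0.
  have v6 : v (6, 0) = 6 by rewrite /v /zs_val /= mul0r addr0.
  rewrite -v2 -v6 /N expr2 -!vM -vD; congr v.
  by rewrite /zs_mul /zs_add /=; congr pair; lra.
have hvn : v n = 2 * N.
  have -> : 2 * N = N + N by ring.
  by rewrite -vD; congr v; rewrite /n /zs_add /=; congr pair; ring.
exists b, s; split=> //.
- move: hj; rewrite /= !horner_quad => /and4P[h1 h2 h3 _].
  split.
    apply: contra_neq h1 => s0; move: hvs; rewrite s0 v0 => hvs.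
    by rewrite mul1r mul0r addr0 -hvs; ring.
  apply: contra_neq (mulf_neq0 h2 h3) => /(congr1 v).
  rewrite !vD vM hvn => hs4.
  have -> : (1 * v b ^+ 2 + 0 * v b + - 2 * N) * (1 * v b ^+ 2 + 0 * v b + - 18 * N)
    = (v b ^+ 2 + 6 * N) ^+ 2 - 32 * N * v b ^+ 2 by ring.
  have -> : (v b ^+ 2 + 6 * N) ^+ 2 = 4 * (v s * v s) * v b ^+ 2 by rewrite -hvs; ring.
  by rewrite hs4; ring.
(* While [s] is half the sum of the factors [b] and [sg b' N] of [6N], [b - s] is half their
   difference, so [s^2 - t^2 = 6N = 3n]. *)
- exists (b.1 - s.1, b.2 - s.2).
  by rewrite /zs_mul /zs_add /=; congr pair; lra.
Qed.

(** * Elements [a] that divide [r^2 - n] *)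

(** As [u1] is odd, [r = (s - 2u) / 2] has an even first coordinate. Hence [r^2 - n = 2w], and [b]
    is [w] times the conjugate of [u], which is its inverse. *)
Lemma pair_of_double_unit (d m k s1 s2 u1 u2 : int) :
  (d %% 4)%Z = 2 -> u1 ^+ 2 - d * u2 ^+ 2 = 1 -> (s1 %% 4)%Z = 2 -> (s2 %% 2)%Z = 0 ->
  exists r b, (s1, s2) = zs_add (2 * u1, 2 * u2) (zs_add r r) /\
    zs_add (zs_mul d (2 * u1, 2 * u2) b) (4 * m + 2, 4 * k) = zs_mul d r r.
Proof.
move=> hd hu hs1 hs2.
have [g ->] := modz_witness _ _ _ hs1.
have [h ->] := modz_witness _ _ _ hs2.
have [e hde] : exists e, d = 2 * e.
  by have [e0 ->] := modz_witness _ _ _ hd; exists (2 * e0 + 1); ring.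
have [i hi] := unit_odd _ _ _ hd hu.
pose w1 := 2 * (g - i) ^+ 2 + e * (h - u2) ^+ 2 - 2 * m - 1.
pose w2 := 2 * (g - i) * (h - u2) - 2 * k.
exists (2 * (g - i), h - u2), (w1 * u1 - d * w2 * u2, w2 * u1 - w1 * u2).
split; first by rewrite /zs_add hi /=; congr pair; ring.
rewrite (@zs_div _ _ _ (2 * w1) (2 * w2) _ _ 4) //.
- by rewrite /zs_add /zs_mul /w1 /w2 hde /=; congr pair; ring.
- by transitivity (4 * (u1 ^+ 2 - d * u2 ^+ 2)); [ring | rewrite hu].
- ring.
- ring.
Qed.

(** Here [r = (s - 4u) / 2] has an even first and an odd second coordinate, so the first coordinate
    of [r^2] is [d = 2] mod 4 and cancels the 2 in [n]; thus [r^2 - n = 4w]. *)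
Lemma pair_of_quadruple_unit (d m k s1 s2 u1 u2 : int) :
  (d %% 4)%Z = 2 -> u1 ^+ 2 - d * u2 ^+ 2 = 1 -> (s1 %% 4)%Z = 0 -> (s2 %% 4)%Z = 2 ->
  exists r b, (s1, s2) = zs_add (4 * u1, 4 * u2) (zs_add r r) /\
    zs_add (zs_mul d (4 * u1, 4 * u2) b) (4 * m + 2, 4 * k) = zs_mul d r r.
Proof.
move=> hd hu hs1 hs2.
have [g ->] := modz_witness _ _ _ hs1.
have [h ->] := modz_witness _ _ _ hs2.
have [e hde] := modz_witness _ _ _ hd.
pose f := h - u2.
pose w1 := (g - u1) ^+ 2 + e + (4 * e + 2) * (f * (f + 1)) - m.
pose w2 := (g - u1) * (2 * f + 1) - k.
exists (2 * (g - u1), 2 * f + 1), (w1 * u1 - d * w2 * u2, w2 * u1 - w1 * u2).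
split; first by rewrite /zs_add /f /=; congr pair; ring.
rewrite (@zs_div _ _ _ (4 * w1) (4 * w2) _ _ 16) //.
- by rewrite /zs_add /zs_mul /w1 /w2 hde /=; congr pair; ring.
- by transitivity (16 * (u1 ^+ 2 - d * u2 ^+ 2)); [ring | rewrite hu].
- ring.
- ring.
Qed.

(* [X1] and [X2] are the coordinates of [r^2 - n] times the conjugate of [a];
   [K] stands for a square root of [d] modulo 3, and [x1 - K x2] is the residue of
   [x] modulo the prime above 3 that divides [a]. *)
Lemma pair_of_norm6 (d m k s1 s2 a1 a2 tau K : int) :
  (d %% 4)%Z = 2 -> (d %% 3)%Z = 1 -> tau ^+ 2 = 1 -> K ^+ 2 = 1 ->
  a1 ^+ 2 - d * a2 ^+ 2 = 6 * tau -> (3 %| a1 - K * a2)%Z -> (a1 %% 2)%Z = 0 ->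
  (4 %| s1 - a1)%Z -> (2 %| s2 - a2)%Z ->
  (3 %| (s1 - K * s2) ^+ 2 - (4 * m + 2 - K * (4 * k)))%Z ->
  exists r b, (s1, s2) = zs_add (a1, a2) (zs_add r r) /\
    zs_add (zs_mul d (a1, a2) b) (4 * m + 2, 4 * k) = zs_mul d r r.
Proof.
move=> hd hd3 htau hK ha /dvdzP[c hc] ha1 /dvdzP[g hg] /dvdzP[h hh] /dvdzP[f hf].
have [e hde] : exists e, d = 2 * e.
  by have [e0 ->] := modz_witness _ _ _ hd; exists (2 * e0 + 1); ring.
have [e3 hde3] := modz_witness _ _ _ hd3.
have [a' ha'] := modz_witness _ _ _ ha1; rewrite addr0 in ha'.
have es1 : s1 = a1 + 4 * g by rewrite -[s1](subrK a1) hg; ring.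
have es2 : s2 = a2 + 2 * h by rewrite -[s2](subrK a2) hh; ring.
have ea1 : a1 = K * a2 + 3 * c by rewrite -[LHS](subrK (K * a2)) hc; ring.
pose z1 := (2 * g) ^+ 2 + d * h ^+ 2 - (4 * m + 2).
pose z2 := 2 * (2 * g) * h - 4 * k.
pose ps := s1 - K * s2; pose pr := 2 * g - K * h.
(* Modulo the prime above 3, [a] vanishes and [4 = 1], so [r^2 = (2r)^2 = (s - a)^2 = s^2]; hence
   [z = r^2 - n] lies in that prime. *)
have [w hw] : exists w, z1 = K * z2 + 3 * w.
  exists (e3 * h ^+ 2 - pr ^+ 2 + f - 2 * c * ps + 3 * c ^+ 2).
  have h1 : z1 - K * z2 = 4 * pr ^+ 2 - 3 * pr ^+ 2 + 3 * e3 * h ^+ 2 - (4 * m + 2 - K * (4 * k)).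
    rewrite /pr; have -> : (2 * g - K * h) ^+ 2 = 4 * g ^+ 2 - 4 * g * K * h + K ^+ 2 * h ^+ 2.
      ring.
    by rewrite hK /z1 /z2 hde3; ring.
  have h2 : 4 * pr ^+ 2 = ps ^+ 2 - 6 * c * ps + 9 * c ^+ 2.
    have -> : ps = 2 * pr + 3 * c by rewrite /ps /pr es1 es2 ea1; ring.
    ring.
  have h3 : ps ^+ 2 = f * 3 + (4 * m + 2 - K * (4 * k)) by rewrite -hf /ps; ring.
  rewrite -[LHS](subrK (K * z2)) addrC; congr (_ + _); rewrite h1 h2 h3; ring.
(* Divisibility by 2 and by 3 combine through [X = 3X - 2X = 6 (t - u)]; [tau] is its own
   inverse. *)
have sixP X t u : X = 2 * t -> X = 3 * u -> X = 6 * tau * (tau * (t - u)).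
  move=> ht hu; have -> : 6 * tau * (tau * (t - u)) = tau ^+ 2 * (3 * (2 * t) - 2 * (3 * u)) by ring.
  by rewrite htau -ht -hu; ring.
have X1 : z1 * a1 - d * z2 * a2 = 6 * tau * (tau * ((z1 * a' - e * z2 * a2) -
    (z1 * c + w * K * a2 - e3 * z2 * a2))).
  apply: sixP; first by rewrite ha' hde; ring.
  rewrite {1}ea1 hde3.
  have -> : z1 * (K * a2 + 3 * c) - (3 * e3 + 1) * z2 * a2 =
     3 * (z1 * c - e3 * z2 * a2) + (K * z1 - z2) * a2 by ring.
  rewrite {2}hw; have -> : K * (K * z2 + 3 * w) = K ^+ 2 * z2 + 3 * w * K by ring.
  by rewrite hK; ring.
have X2 : z2 * a1 - z1 * a2 = 6 * tau * (tau * ((z2 * a' -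
    (2 * g ^+ 2 + e * h ^+ 2 - 2 * m - 1) * a2) - (z2 * c - w * a2))).
  apply: sixP; first by rewrite ha' /z1 hde; ring.
  by rewrite {1}ea1 hw; ring.
have tau0 : 6 * tau != 0.
  by rewrite mulf_neq0 //; apply: contra_eq_neq htau => ->; rewrite expr0n.
have [b hb] : exists b, zs_mul d (a1, a2) b = (z1, z2).
  by eexists; exact: zs_div ha tau0 X1 X2.
exists (2 * g, h), b; rewrite hb; split.
  by rewrite /zs_add es1 es2 /=; congr pair; ring.
by rewrite /z1 /z2 /zs_add /zs_mul /=; congr pair; ring.
Qed.

(** Modulo the prime containing [b], [N] has residue [t] and [2s = sg b' N] gives [s = sg K b2 t].
    Since 9 does not divide the norm of [b], [b2^2 = 1] mod 3, so [s^2 = t^2], to be compared with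
    [n = 2t]. They differ only for [t = 1], that is, [m = K k] mod 3. *)
Lemma square_mod3 (d m k b1 b2 s1 s2 sg K : int) :
  (d %% 3)%Z = 1 -> sg ^+ 2 = 1 -> K ^+ 2 = 1 ->
  b1 ^+ 2 - d * b2 ^+ 2 = 6 * sg -> (3 %| b1 - K * b2)%Z ->
  2 * s1 = b1 + sg * (b1 * (2 * m + 1) - 2 * k * d * b2) ->
  2 * s2 = b2 + sg * (2 * k * b1 - b2 * (2 * m + 1)) ->
  ~~ (3 %| m - K * k)%Z ->
  (3 %| (s1 - K * s2) ^+ 2 - (4 * m + 2 - K * (4 * k)))%Z.
Proof.
move=> hd3 hsg hK hb /dvdzP[c hc] hs1 hs2 hmk.
have [e hde] := modz_witness _ _ _ hd3.
have eb1 : b1 = K * b2 + 3 * c by rewrite -[LHS](subrK (K * b2)) hc; ring.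
have [i hi] : exists i, b2 ^+ 2 = 3 * i + 1.
  have [i [ei|ei|ei]] := third_int b2; last 2 first.
  - by exists (3 * i ^+ 2 + 2 * i); rewrite ei; ring.
  - by exists (3 * i ^+ 2 + 4 * i + 1); rewrite ei; ring.
  have : 9 * ((K * i + c) ^+ 2 - d * i ^+ 2) = 6 * sg by rewrite -hb eb1 ei; ring.
  move: (_ - _) => z; clear -hsg.
  by move/eqP: hsg; rewrite sqrf_eq1 => /orP[] /eqP ->; lia.
pose t := 2 * m + 1 - 2 * K * k.
have [j hj] : exists j, t ^+ 2 - 2 * t = 3 * j.
  have [j [ej|ej|ej]] := third_int t.
  - by exists (3 * j ^+ 2 - 2 * j); rewrite ej; ring.
  - by rewrite /t in ej; lia.
  - by exists (3 * j ^+ 2 + 2 * j); rewrite ej; ring.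
pose A := sg * K * b2 * t.
have hA : A ^+ 2 = (3 * i + 1) * t ^+ 2.
  have -> : A ^+ 2 = sg ^+ 2 * K ^+ 2 * b2 ^+ 2 * t ^+ 2 by rewrite /A; ring.
  by rewrite hsg hK hi; ring.
have [g hg] : exists g, s1 - K * s2 = A + 3 * g.
  pose B := c + sg * c * t - 2 * sg * k * e * b2.
  have h2 : 2 * (s1 - K * s2) = 2 * A + 3 * B.
    have -> : 2 * (s1 - K * s2) = 2 * s1 - K * (2 * s2) by ring.
    rewrite hs1 hs2 hde eb1 /A /B /t.
    by move/eqP: hK; rewrite sqrf_eq1 => /orP[] /eqP ->; ring.
  (* From [2X = 2A + 3B] one gets [X = 3X - 2X = A + 3 (X - A - B)]. *)
  exists (s1 - K * s2 - A - B).
  rewrite [RHS](_ : _ = 3 * (s1 - K * s2) - (2 * A + 3 * B)); last by ring.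
  by rewrite -h2; ring.
apply/dvdzP; exists (i * t ^+ 2 + j + 2 * A * g + 3 * g ^+ 2).
rewrite hg (_ : (A + 3 * g) ^+ 2 = A ^+ 2 + 6 * A * g + 9 * g ^+ 2); last by ring.
rewrite hA (_ : _ - K * _ = 2 * t); last by rewrite /t; ring.
apply/eqP; rewrite -subr_eq0; apply/eqP.
by rewrite -[RHS](subrr (3 * j)) -{1}hj; ring.
Qed.

(** * Case analysis on [(m, k)] *)

Lemma infinite_of_unit_multiples (d p q c : int) (n s : zsqrt) :
  0 < d -> (d %% 4)%Z = 2 -> p ^+ 2 - d * q ^+ 2 = -1 -> c != 0 ->
  s != (0, 0) -> zs_mul d s s != zs_add (zs_add n n) (zs_add n n) ->
  (exists t, zs_mul d s s = zs_add (zs_mul d t t) (zs_add n (zs_add n n))) ->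
  (forall u : zsqrt, zs_norm d u = 1 -> exists r b,
     s = zs_add (c * u.1, c * u.2) (zs_add r r) /\
     zs_add (zs_mul d (c * u.1, c * u.2) b) n = zs_mul d r r) ->
  infinitely_many_Dn_quadruples d n.
Proof.
move=> d0 hd hpq c0 s0 s4n [t ht] H.
have [U [Uinj hU]] := unit_seq _ _ _ d0 hd hpq.
apply: (infinitely_many_regular d n s t (fun j => (c * (U j).1, c * (U j).2))) => //.
  by move=> i j [/(mulfI c0) h1 /(mulfI c0) h2]; exact/Uinj/injective_projections.
by move=> j; apply: H.
Qed.

(** The norm fixes [b1] mod 4 but [b2] only mod 2, so the claims on [s2] mod 4 assume that the
    coefficient of [b2], which is [-m] or [m + 1], is even. *)
Lemma center_mod4 (d m k b1 b2 s1 s2 sg : int) :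
  (d %% 8)%Z = 2 -> b1 ^+ 2 - d * b2 ^+ 2 = 6 * sg ->
  2 * s1 = b1 + sg * (b1 * (2 * m + 1) - 2 * k * d * b2) ->
  2 * s2 = b2 + sg * (2 * k * b1 - b2 * (2 * m + 1)) ->
  (sg = 1 -> [/\ (s1 %% 4)%Z = (2 * k %% 4)%Z, (s2 %% 2)%Z = (m %% 2)%Z &
     (m %% 2)%Z = 0 -> (s2 %% 4)%Z = (m %% 4)%Z]) /\
  (sg = -1 -> [/\ (s1 %% 4)%Z = (2 * (m + k) %% 4)%Z, (s2 %% 2)%Z = ((m + 1) %% 2)%Z &
     (m %% 4)%Z = 3 -> (k %% 2)%Z = 1 -> (s2 %% 4)%Z = 2]).
Proof.
move=> hd hb hs1 hs2; have [e hde] := modz_witness _ _ _ hd.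
split=> esg; subst sg.
- have [hb1 hb2] := norm6_mod4 _ _ _ hd hb.
  have [x ex] := modz_witness _ _ _ hb1; have [y ey] := modz_witness _ _ _ hb2.
  have e1 : s1 = (4 * x) * (1 + m) - k * d * b2.
    by apply: (mulfI (_ : 2 != 0)) => //; rewrite hs1 ex; ring.
  have e2 : s2 = k * (4 * x) - m * b2.
    by apply: (mulfI (_ : 2 != 0)) => //; rewrite hs2 ex; ring.
  rewrite e1 e2 ey hde; clear; split; [lia | lia | ].
  move=> hm; have [i ->] := modz_witness _ _ _ hm; lia.
- have [hb1 hb2] := normN6_mod4 _ _ _ hd hb.
  have [x ex] := modz_witness _ _ _ hb1; have [y ey] := modz_witness _ _ _ hb2.
  have e1 : s1 = - (4 * x + 2) * m + k * d * b2.
    by apply: (mulfI (_ : 2 != 0)) => //; rewrite hs1 ex; ring.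
  have e2 : s2 = (m + 1) * b2 - k * (4 * x + 2).
    by apply: (mulfI (_ : 2 != 0)) => //; rewrite hs2 ex; ring.
  rewrite e1 e2 ey hde; clear; split; [lia | lia | ].
  move=> hm hk; have [i ->] := modz_witness _ _ _ hm.
  have [j ->] := modz_witness _ _ _ hk; lia.
Qed.

Theorem theorem1p3 (d m k : int) :
  0 < d -> (d %% 4)%Z = 2 -> squarefree_int d ->
  (exists x y : int, x ^+ 2 - d * y ^+ 2 = -1) ->
  (exists x y : int, x ^+ 2 - d * y ^+ 2 = 6) ->
  ~ ((m %% 12)%Z = 9 /\ (k %% 6)%Z = 3) ->
  ~ ((m %% 12)%Z = 0 /\ (k %% 6)%Z = 0) ->
  infinitely_many_Dn_quadruples d (4 * m + 2, 4 * k).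
Proof.
move=> d0 hd _ [p [q hpq]] [x [y hxy]] hex1 hex2.
have hd8 := negative_pell_mod8 _ _ _ hd hpq; have hd3 := negative_pell_norm6_mod3 _ _ _ _ _ hpq hxy.
(* Both signs fail only if 3 divides [m - k] and [m + k], hence [m] and [k]; with the classes mod 4
   and mod 2 treated by [norm6], this gives exactly the exceptional pairs. *)
have [K [hK hmk]] : exists K : int, K ^+ 2 = 1 /\
    (~~ (3 %| m - K * k)%Z \/ (m %% 3)%Z = 0 /\ (k %% 3)%Z = 0).
  have [h|h] : (~~ (3 %| m - 1 * k)%Z \/ (m %% 3)%Z = 0 /\ (k %% 3)%Z = 0) \/
     (~~ (3 %| m - -1 * k)%Z) by clear; lia.
  - by exists 1.
  - by exists (-1); split=> //; left.
have double (sg : int) : sg ^+ 2 = 1 ->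
    (sg = 1 /\ (m %% 2)%Z = 0 /\ (k %% 2)%Z = 1 \/
     sg = -1 /\ (m %% 2)%Z = 1 /\ (k %% 2)%Z = 0) ->
    infinitely_many_Dn_quadruples d (4 * m + 2, 4 * k).
  move=> hsg hmk2.
  have [[b1 b2] [[s1 s2] [hb _ [hs1 hs2] [s0 s4n] ht]]] :=
    center_exists _ _ _ _ _ _ _ m k d0 hd hpq hxy hsg hK.
  have [h1 h2] := center_mod4 _ _ _ _ _ _ _ _ hd8 hb hs1 hs2.
  apply: (infinite_of_unit_multiples d p q 2 _ (s1, s2)) => // u hu.
  apply: pair_of_double_unit => //.
  - case: hmk2 => [[e [hm hk]]|[e [hm hk]]]; [have [-> _ _] := h1 e | have [-> _ _] := h2 e];
    clear -hm hk; lia.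
  - case: hmk2 => [[e [hm hk]]|[e [hm hk]]]; [have [_ -> _] := h1 e | have [_ -> _] := h2 e];
    clear -hm hk; lia.
have quadruple (sg : int) : sg ^+ 2 = 1 ->
    (sg = 1 /\ (m %% 4)%Z = 2 /\ (k %% 2)%Z = 0 \/
     sg = -1 /\ (m %% 4)%Z = 3 /\ (k %% 2)%Z = 1) ->
    infinitely_many_Dn_quadruples d (4 * m + 2, 4 * k).
  move=> hsg hmk2.
  have [[b1 b2] [[s1 s2] [hb _ [hs1 hs2] [s0 s4n] ht]]] :=
    center_exists _ _ _ _ _ _ _ m k d0 hd hpq hxy hsg hK.
  have [h1 h2] := center_mod4 _ _ _ _ _ _ _ _ hd8 hb hs1 hs2.
  apply: (infinite_of_unit_multiples d p q 4 _ (s1, s2)) => // u hu.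
  apply: pair_of_quadruple_unit => //.
  - case: hmk2 => [[e [hm hk]]|[e [hm hk]]]; [have [-> _ _] := h1 e | have [-> _ _] := h2 e];
    clear -hm hk; lia.
  - case: hmk2 => [[e [hm hk]]|[e [hm hk]]]; last by have [_ _ ->] := h2 e.
    by have [_ _ ->] := h1 e; clear -hm; lia.
have norm6 (sg : int) : sg ^+ 2 = 1 -> ~~ (3 %| m - K * k)%Z ->
    (sg = 1 /\ (m %% 4)%Z = 1 /\ (k %% 2)%Z = 1 \/
     sg = -1 /\ (m %% 4)%Z = 0 /\ (k %% 2)%Z = 0) ->
    infinitely_many_Dn_quadruples d (4 * m + 2, 4 * k).
  move=> hsg hmK hmk2.
  have [[b1 b2] [[s1 s2] [hb hb3 [hs1 hs2] [s0 s4n] [t ht]]]] :=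
    center_exists _ _ _ _ _ _ _ m k d0 hd hpq hxy hsg hK.
  have [h1 h2] := center_mod4 _ _ _ _ _ _ _ _ hd8 hb hs1 hs2.
  (* The sign opposite to that of [b] gives [a1 = s1] mod 4: both are 2 for [sg = 1] and 0 for
     [sg = -1]. *)
  have hsN : (- sg) ^+ 2 = 1 by rewrite sqrrN.
  have [W [Winj hW]] := norm6_seq _ _ _ _ _ _ _ d0 hd hpq hxy hsN hK.
  apply: (infinitely_many_regular d _ (s1, s2) t W) => // j.
  have [] := hW j; case: (W j) => a1 a2 /= ha ha3.
  have sq3 := square_mod3 _ _ _ _ _ _ _ _ _ hd3 hsg hK hb hb3 hs1 hs2 hmK.
  have [ha1 [hs1' hs2']] : (a1 %% 2)%Z = 0 /\ (4 %| s1 - a1)%Z /\ (2 %| s2 - a2)%Z.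
    rewrite /zs_norm /= in ha.
    case: hmk2 => -[e [hm hk]]; rewrite e in ha.
    + have [a1m a2m] := normN6_mod4 _ _ _ hd8 ha; have [r1 r2 _] := h1 e.
      by move: r1 r2; clear -a1m a2m hm hk => /=; lia.
    + have [a1m a2m] := norm6_mod4 _ _ _ hd8 ha; have [r1 r2 _] := h2 e.
      by move: r1 r2; clear -a1m a2m hm hk => /=; lia.
  exact: (pair_of_norm6 _ _ _ _ _ _ _ (- sg) K).
have [h|[h|[h|[h|[h|h]]]]] :
  ((m %% 2)%Z = 0 /\ (k %% 2)%Z = 1) \/ ((m %% 2)%Z = 1 /\ (k %% 2)%Z = 0) \/
  ((m %% 4)%Z = 2 /\ (k %% 2)%Z = 0) \/ ((m %% 4)%Z = 3 /\ (k %% 2)%Z = 1) \/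
  ((m %% 4)%Z = 1 /\ (k %% 2)%Z = 1) \/ ((m %% 4)%Z = 0 /\ (k %% 2)%Z = 0).
  by clear; lia.
- by apply: (double 1) => //; left.
- by apply: (double (-1)) => //; right.
- by apply: (quadruple 1) => //; left.
- by apply: (quadruple (-1)) => //; right.
- apply: (norm6 1) => //; last by left.
  by case: hmk => // hmk; case: hex1; clear -h hmk; lia.
- apply: (norm6 (-1)) => //; last by right.
  by case: hmk => // hmk; case: hex2; clear -h hmk; lia.
Qed.
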